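(* Let $(\mathfrak g,\mathfrak v,\pi)$ be a Lorentzian data set and let $\mathfrak c$ be the center of $\mathfrak g$. If $\mathfrak v$ is Lorentzian, then: (1) $\mathfrak v$ decomposes as an orthogonal sum $\mathfrak v=\mathfrak v_0\oplus\mathfrak v_1\oplus\cdots\oplus\mathfrak v_k$ of $\pi(\mathfrak g)$-invariant subspaces, where $\mathfrak v_i$ is Riemannian and irreducible for $i\ge 1$, and $\mathfrak v_0$ is Lorentzian of dimension $2$, which is in turn the sum of two invariant (and irreducible) subspaces of dimension $1$ generated by lightlike vectors. (2) For every $i=1,\dots,k$ there exists a skew-symmetric map $J_i:\mathfrak v_i\to\mathfrak v_i$ such that $J_i^2=-\mathrm{Id}$ and for every $Z\in\mathfrak c$, $\pi(Z)|_{\mathfrak v_i}=\lambda_i(Z)J_i$ for some $\lambda_i(Z)\in\mathbb R$. (3) There exists a map $J_0\in\mathfrak{so}(\mathfrak v_0)\simeq\mathfrak{so}(1,1)$ such that $J_0^2=\mathrm{Id}$ and for every $Z\in\mathfrak c$, $\pi(Z)|_{\mathfrak v_0}=\lambda_0(Z)J_0$ for some $\lambda_0(Z)\in\mathbb R$.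
   Context: All vector spaces and Lie algebras are real and finite-dimensional; ''metric'' or ''inner product'' means a non-degenerate symmetric bilinear form, not necessarily definite. $\mathfrak{so}(V)$ is the Lie algebra of skew-symmetric endomorphisms of $V$ with respect to its metric. A data set is a triple $(\mathfrak g,\mathfrak v,\pi)$ where: $\mathfrak g$ is a Lie algebra with an ad-invariant metric $\langle\cdot,\cdot\rangle_{\mathfrak g}$ (i.e. $\mathrm{ad}_Z\in\mathfrak{so}(\mathfrak g)$ for all $Z\in\mathfrak g$); $\mathfrak v$ is a real vector space; $\pi:\mathfrak g\to\mathrm{End}(\mathfrak v)$ is a real faithful representation without trivial subrepresentations, i.e. $\bigcap_{Z\in\mathfrak g}\ker\pi(Z)=\{0\}$; and $\mathfrak v$ has a $\pi(\mathfrak g)$-invariant inner product $\langle\cdot,\cdot\rangle_{\mathfrak v}$, i.e. $\pi(\mathfrak g)\subset\mathfrak{so}(\mathfrak v)$. It is a Lorentzian data set if the orthogonal direct sum metric on $\mathfrak n=\mathfrak g\oplus\mathfrak v$ has signature one (exactly one negative direction). Then one of $\mathfrak g,\mathfrak v$ is Riemannian (positive definite) and the other is Lorentzian (signature one). The same terms Riemannian/Lorentzian apply to subspaces with the restricted form. A nonzero vector $x$ is lightlike if $\langle x,x\rangle=0$.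
   Formalization: Part (2) as stated fails for odd-dimensional v_i (e.g. so(3)+R on R^3+R^{1,1}); the formal version says that for each i≥1 either J_i and λ_i exist as claimed, or dim v_i is odd and the center acts as zero on v_i. *)

(* Defs.v *)
From HB Require Import structures.
From mathcomp Require Import all_boot all_order all_algebra.
From mathcomp Require Import reals.

Set Implicit Arguments.
Unset Strict Implicit.
Unset Printing Implicit Defensive.

Import Order.TTheory GRing.Theory Num.Theory.

Local Open Scope ring_scope.

HB.mixin Record Vector_isLie (R : nzRingType) V of Vector R V := {
  lie : V -> V -> V;
  lie_linearl : forall y, linear (lie ^~ y);
  lie_linearr : forall x, linear (lie x);
  liexx : forall x, lie x x = 0;
  lie_jacobi : forall x y z,
    lie x (lie y z) + lie y (lie z x) + lie z (lie x y) = 0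
}.

#[short(type="lieAlgType")]
HB.structure Definition LieAlgebra (R : nzRingType) :=
  {V of Vector R V & Vector_isLie R V}.

Definition in_center (R : nzRingType) (g : lieAlgType R) (Z : g) : Prop :=
  forall X : g, lie Z X = 0.

Definition restr_form (R : fieldType) (V : vectType R) (B : {symmetric V})
  (U : {vspace V}) (x y : subvs_of U) : R := B (vsval x) (vsval y).

Section RestrForm.
Variables (R : fieldType) (V : vectType R) (B : {symmetric V}).
Variable U : {vspace V}.

Fact restr_form_bilinear :
  bilinear_for *%R (idfun \; *%R) (restr_form B (U := U)).
Proof.
split=> [y a x x'|x a y y']; rewrite /restr_form !linearP //.
by rewrite linearPl.
Qed.

Fact restr_form_sym (x y : subvs_of U) :
  restr_form B x y = (-1) ^+ false * idfun (restr_form B y x).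
Proof. exact: (@hermitian_subproof _ _ _ _ B). Qed.

HB.instance Definition _ := bilinear_isBilinear.Build R (subvs_of U)
  (subvs_of U) R *%R (idfun \; *%R) (restr_form B (U := U)) restr_form_bilinear.
HB.instance Definition _ := isHermitianSesquilinear.Build R (subvs_of U)
  false idfun (restr_form B (U := U)) restr_form_sym.
End RestrForm.

Definition sum_form (R : fieldType) (V W : vectType R) (B : {symmetric V})
  (C : {symmetric W}) (x y : (V * W)%type) : R := B x.1 y.1 + C x.2 y.2.

Section SumForm.
Variables (R : fieldType) (V W : vectType R).
Variables (B : {symmetric V}) (C : {symmetric W}).

Fact sum_form_bilinear : bilinear_for *%R (idfun \; *%R) (sum_form B C).
Proof.
split=> [y a x x'|x a y y']; rewrite /sum_form /=.
  by rewrite !linearPl /= mulrDr addrACA.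
by rewrite !linearPr /= mulrDr addrACA.
Qed.

Fact sum_form_sym (x y : V * W) :
  sum_form B C x y = (-1) ^+ false * idfun (sum_form B C y x).
Proof.
rewrite /sum_form (@hermitian_subproof _ _ _ _ B) (@hermitian_subproof _ _ _ _ C).
by rewrite /= -mulrDr.
Qed.

HB.instance Definition _ := bilinear_isBilinear.Build R (V * W)%type
  (V * W)%type R *%R (idfun \; *%R) (sum_form B C) sum_form_bilinear.
HB.instance Definition _ := isHermitianSesquilinear.Build R (V * W)%type
  false idfun (sum_form B C) sum_form_sym.
End SumForm.

Section Signature.
Variables (R : realType) (V : vectType R) (B : {symmetric V}).

Definition riemannian : Prop := forall x : V, x != 0 -> 0 < B x x.

Definition negdef_on (U : {vspace V}) : Prop :=
  forall x : V, x \in U -> x != 0 -> B x x < 0.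

(* Number of negative directions: the largest dimension of a negative
   definite subspace. *)
Definition has_index (n : nat) : Prop :=
  (exists2 U : {vspace V}, negdef_on U & \dim U = n) /\
  (forall U : {vspace V}, negdef_on U -> (\dim U <= n)%N).

Definition lorentzian : Prop := nondegenerate B /\ has_index 1.

Definition lightlike (x : V) : Prop := x != 0 /\ B x x = 0.

Definition in_so (f : 'End(V)) : Prop := forall x y : V, B (f x) y = - B x (f y).
End Signature.

Record dataSet (R : realType) (g : lieAlgType R) (v : vectType R) := DataSet {
  metric_g : {symmetric g};
  metric_v : {symmetric v};
  rho : {linear g -> 'End(v)};
  metric_g_nondeg : nondegenerate metric_g;
  metric_v_nondeg : nondegenerate metric_v;
  metric_g_adinv : forall Z X Y : g,
    metric_g (lie Z X) Y = - metric_g X (lie Z Y);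
  rho_lie : forall X Y : g,
    rho (lie X Y) = (rho X \o rho Y)%VF - (rho Y \o rho X)%VF;
  rho_faithful : injective rho;
  rho_no_trivial : forall x : v, (forall Z : g, rho Z x = 0) -> x = 0;
  rho_so : forall Z : g, in_so metric_v (rho Z)
}.

Definition lorentzian_dataSet (R : realType) (g : lieAlgType R)
    (v : vectType R) (D : dataSet g v) : Prop :=
  lorentzian (sum_form (metric_g D) (metric_v D)).

Section Subspaces.
Variables (R : realType) (g : lieAlgType R) (v : vectType R) (D : dataSet g v).

Definition riemannian_sub (U : {vspace v}) : Prop :=
  riemannian (restr_form (metric_v D) (U := U)).

Definition lorentzian_sub (U : {vspace v}) : Prop :=
  lorentzian (restr_form (metric_v D) (U := U)).

Definition rep_invariant (U : {vspace v}) : Prop :=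
  forall Z : g, (rho D Z @: U <= U)%VS.

Definition rep_irreducible (U : {vspace v}) : Prop :=
  [/\ rep_invariant U, U != 0%VS &
      forall W : {vspace v}, rep_invariant W -> (W <= U)%VS ->
        W = 0%VS \/ W = U].

Definition in_so_sub (U : {vspace v}) (J : 'End(subvs_of U)) : Prop :=
  in_so (restr_form (metric_v D) (U := U)) J.

Definition acts_as (Z : g) (U : {vspace v}) (a : R) (J : 'End(subvs_of U)) :
  Prop := forall x : subvs_of U, rho D Z (vsval x) = a *: vsval (J x).
End Subspaces.

(* Main.v *)
Require Import Defs.
From HB Require Import structures.
From mathcomp Require Import all_boot all_order all_algebra.
From mathcomp Require Import boolp reals.
From mathcomp Require Import complex ring lra.

(** Write A for the representation and B for the form on v. A negative vector
    of g would give g + v a second negative direction, so g is positive definite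
    ([metric_g_riemannian]).

    The heart of the proof is the existence of a boost: some Z in g and e != 0
    with A Z e = a e and a != 0 ([exists_boost]). Suppose there is none. An
    invariant null line would then be killed by g, so no line of this kind
    exists; since the radical of an invariant subspace is totally null, hence
    at most a line, every invariant subspace is non-degenerate, and a minimal
    invariant subspace E with a timelike vector is irreducible. The Casimir
    operator C, the sum of the squares of A over an orthonormal basis of g,
    commutes with A, and B (C x) x < 0 for every nonzero causal x: A Z x is
    orthogonal to x, hence of nonnegative square, and these squares cannot all
    vanish. This forces C to be a positive scalar on E ([casimir_scalar]). So
    some A Z has a square of positive trace on E, and therefore an eigenvalue
    with nonzero real part ([positive_square_eigen_pair]). The eigenvectors of
    a skew map for such an eigenvalue are null, and two orthogonal null vectors
    of a Lorentzian space are collinear, so the eigenvalue is real: A Z is a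
    boost after all.

    Now let A Z e = a e be a boost. The map X |-> A X e intertwines ad Z, which
    has imaginary spectrum because g is definite, with A Z - a; so its values
    are combinations of vectors on which A Z has an eigenvalue of real part a.
    These are null and orthogonal to e, thus on the line of e, which is
    therefore invariant ([boost_line_invariant]). By skewness -a is an
    eigenvalue too, with an eigenvector f that is not orthogonal to e. The plane
    of e and f is V 0, and A Z / a is J on it.

    The orthogonal complement of V 0 is positive definite, so it splits into
    orthogonal irreducible pieces. On such a piece a symmetric operator that
    commutes with A is a scalar ([symmetric_commuting_scalar]). The product of
    two central elements is such an operator, so that a central Z acting
    non-trivially has square - t^2, and every central element acts as a multiple
    of J = A Z / t. If the center acts trivially on a piece of even dimension,
    J exchanges up to sign the vectors of an orthonormal basis two by two. *)

Set Implicit Arguments.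
Unset Strict Implicit.
Unset Printing Implicit Defensive.

Import Order.TTheory GRing.Theory Num.Theory.

Local Open Scope ring_scope.

(** * Real pairs of vectors spanning complex eigenlines *)

Section ComplexEigenvectors.
Import VectorInternalTheory.
Variable R : realType.
Implicit Types V : vectType R.

(** These equations say that x + i y is an eigenvector of the complexification
    of f for the eigenvalue a + i b; speaking of real pairs keeps the complex
    numbers confined to this part. *)
Definition eigen_pair V (f : 'End(V)) (a b : R) (x y : V) : Prop :=
  [/\ (x != 0) || (y != 0), f x = a *: x - b *: y & f y = b *: x + a *: y].

Local Notation toC := (real_complex R).

Lemma v2r_lfun V (f : 'End(V)) x : v2r x *m f2mx f = v2r (f x).
Proof. by rewrite unlock /= r2vK. Qed.

Lemma eigenvalue_eigen_pair V (f : 'End(V)) (s : R[i]) :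
  eigenvalue (map_mx toC (f2mx f)) s ->
  exists x y, eigen_pair f (complex.Re s) (complex.Im s) x y.
Proof.
case: s => a b /eigenvalueP[w wM w0] /=.
pose p := map_mx (@complex.Re R) w; pose q := map_mx (@complex.Im R) w.
have wE k : w 0 k = Complex (p 0 k) (q 0 k) by rewrite !mxE; case: (w 0 k).
have wMk k : Complex ((p *m f2mx f) 0 k) ((q *m f2mx f) 0 k)
    = Complex (a * p 0 k - b * q 0 k) (a * q 0 k + b * p 0 k).
  transitivity (\sum_j w 0 j * (map_mx toC (f2mx f)) j k).
    under eq_bigr => j _.
      rewrite wE [map_mx _ _ _ _]mxE.
      have -> : Complex (p 0 j) (q 0 j) * toC (f2mx f j k)
           = toC (p 0 j * f2mx f j k) + Complex 0 1 * toC (q 0 j * f2mx f j k).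
        by apply/eqP; rewrite eq_complex /=; apply/andP; split; apply/eqP; ring.
      over.
    rewrite big_split -mulr_sumr -!rmorph_sum !mxE /=.
    by apply/eqP; rewrite eq_complex /=; apply/andP; split; apply/eqP; ring.
  have := congr1 (fun m : 'rV_ _ => m 0 k) wM; rewrite !mxE => ->; rewrite wE.
  by apply/eqP; rewrite eq_complex /=; apply/andP; split; apply/eqP; ring.
exists (r2v p), (r2v q); split.
- apply: contra_neqT w0; rewrite negb_or !negbK => /andP[/eqP p0 /eqP q0].
  apply/rowP => k; rewrite wE -[p]r2vK -[q]r2vK p0 q0 linear0 !mxE.
  by apply/eqP; rewrite eq_complex /= !eqxx.
- apply: (can_inj v2rK); rewrite -v2r_lfun linearB !linearZ /= r2vK r2vK.
  by apply/rowP => k; have [H _] := wMk k; rewrite H !mxE mulrN.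
- apply: (can_inj v2rK); rewrite -v2r_lfun linearD !linearZ /= r2vK r2vK.
  by apply/rowP => k; have [_ H] := wMk k; rewrite H !mxE addrC.
Qed.

Lemma eigen_pair_exists V (f : 'End(V)) : (0 < dim V)%N ->
  exists a b x y, eigen_pair f a b x y.
Proof.
move=> V0; pose M := map_mx toC (f2mx f).
have [r rM] := closed_field_poly_normal (char_poly M).
have := size_char_poly M; rewrite rM (monicP (char_poly_monic M)) scale1r.
rewrite size_prod_XsubC => -[sr]; case: r sr rM => [|s r] /= sr rM.
  by rewrite -sr in V0.
have /eigenvalue_eigen_pair[x [y xy]] : eigenvalue M s.
  rewrite eigenvalue_root_char rM rootZ ?lead_coef_eq0 ?monic_neq0 ?char_poly_monic//.
  by rewrite root_prod_XsubC mem_head.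
by exists (complex.Re s), (complex.Im s), x, y.
Qed.

(** The trace of f^2 is the sum of its complex eigenvalues, so one of them has
    positive real part. A square root s of it has nonzero real part, and s or -s
    is an eigenvalue of f because f^2 - s^2 = (f - s)(f + s). *)
Lemma positive_square_eigen_pair V (f : 'End(V)) :
  0 < \tr (f2mx f *m f2mx f) ->
  exists a b x y, a != 0 /\ eigen_pair f a b x y.
Proof.
move=> tr0; pose M := map_mx toC (f2mx f).
have n0 : (0 < dim V)%N.
  rewrite lt0n; apply: contraTneq tr0 => n0.
  by rewrite /mxtrace big1 ?ltxx // => -[k klt] _; exfalso; rewrite n0 in klt.
have [r rM] := closed_field_poly_normal (char_poly (M *m M)).
have sr := size_char_poly (M *m M); rewrite rM (monicP (char_poly_monic _)) in sr.
rewrite scale1r size_prod_XsubC in sr; case: sr => sr.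
have trE : \sum_(z <- r) z = toC (\tr (f2mx f *m f2mx f)).
  have := char_poly_trace (M *m M) n0.
  rewrite rM (monicP (char_poly_monic _)) scale1r -[in X in X = _]sr coefPn_prod_XsubC; last first.
    by rewrite sr -lt0n.
  by move/oppr_inj ->; rewrite -map_mxM trace_map_mx.
have [z zr z0] : exists2 z, z \in r & 0 < complex.Re z.
  apply/hasP; apply: contraTT tr0 => /hasPn rneg; rewrite -leNgt.
  rewrite -[X in X <= _]/(complex.Re (toC (\tr (f2mx f *m f2mx f)))) -trE.
  rewrite (_ : complex.Re _ = \sum_(z <- r) complex.Re z); last first.
    by apply: (big_morph (@complex.Re R)) => // -[? ?] [].
  by rewrite big_seq; apply: sumr_le0 => z /rneg; rewrite -leNgt.
have sz := sqr_sqrtc z; set s := sqrtc z in sz.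
have s0 : complex.Re s != 0.
  apply: contraTneq z0; rewrite -sz expr2; case: (s) => a b /= ->.
  by rewrite -leNgt mul0r sub0r oppr_le0 -expr2 sqr_ge0.
have : \det (z%:M - M *m M) == 0.
  have : root (char_poly (M *m M)) z.
    by rewrite rM rootZ ?lead_coef_eq0 ?monic_neq0 ?char_poly_monic// root_prod_XsubC.
  rewrite -eigenvalue_root_char => /eigenvalueP[w wM w0].
  by apply/det0P; exists w => //; rewrite mulmxBr wM mul_mx_scalar subrr.
have eigS t : \det (t%:M - M) = 0 -> eigenvalue M t.
  move/eqP/det0P => [w w0 wM]; apply/eigenvalueP; exists w => //.
  by apply/eqP; rewrite eq_sym -subr_eq0 -mul_mx_scalar -mulmxBr wM.
have -> : z%:M - M *m M = (s%:M - M) *m (-1 *: ((- s)%:M - M)).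
  rewrite scaleN1r opprB raddfN /= opprK mulmxBl !mulmxDr -scalar_mxM -expr2 sz.
  by rewrite scalar_mxC opprD [RHS]addrC addrA subrK addrC.
rewrite det_mulmx detZ mulf_eq0 mulf_eq0 signr_eq0 /=.
case/orP=> /eqP /eigS /eigenvalue_eigen_pair[x [y xy]].
  by exists (complex.Re s), (complex.Im s), x, y.
exists (complex.Re (- s)), (complex.Im (- s)), x, y; split=> //.
by move: s0; case: (s) => a b /=; rewrite oppr_eq0.
Qed.

(** Comparing traces: a positive scalar has positive trace, hence so does the
    square of one of the A i. *)
Lemma sum_squares_eigen_pair V (I : finType) (A : I -> 'End(V)) (c : R) :
    (0 < dim V)%N -> 0 < c -> (forall x, \sum_i A i (A i x) = c *: x) ->
  exists i a b x y, a != 0 /\ eigen_pair (A i) a b x y.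
Proof.
move=> n0 c0 AE.
have trE : \sum_i \tr (f2mx (A i) *m f2mx (A i)) = c *+ dim V.
  rewrite -raddf_sum /= -mxtrace_scalar; congr (\tr _); apply/row_matrixP => k.
  rewrite !rowE mulmx_sumr; set u := delta_mx _ _.
  rewrite mul_mx_scalar -(r2vK u) -linearZ -AE linear_sum /=.
  by apply: eq_bigr => i _; rewrite mulmxA !v2r_lfun.
have [i Ai] : exists i, 0 < \tr (f2mx (A i) *m f2mx (A i)).
  apply/existsP; apply: contraTT (c0) => /existsPn neg.
  rewrite -leNgt -(pmulrn_lle0 _ n0) -trE; apply: sumr_le0 => i _.
  by rewrite leNgt.
by have [a [b [x [y ?]]]] := positive_square_eigen_pair Ai; exists i, a, b, x, y.
Qed.

End ComplexEigenvectors.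

(** * Symmetric bilinear forms *)

Section SymmetricForms.
Variables (R : realType) (V : vectType R) (B : {symmetric V}).
Implicit Types (x y z u : V) (U W : {vspace V}).

Lemma symformC x y : B x y = B y x.
Proof. by have := @hermitian_subproof _ _ _ _ B x y; rewrite expr0 mul1r. Qed.

Lemma symform0l x : B 0 x = 0. Proof. exact: linear0l. Qed.
Lemma symform0r x : B x 0 = 0. Proof. exact: linear0r. Qed.
Lemma symformDl x y z : B (x + y) z = B x z + B y z. Proof. exact: linearDl. Qed.
Lemma symformDr x y z : B z (x + y) = B z x + B z y. Proof. exact: linearDr. Qed.
Lemma symformNl x y : B (- x) y = - B x y. Proof. exact: linearNl. Qed.
Lemma symformNr x y : B y (- x) = - B y x. Proof. exact: linearNr. Qed.
Lemma symformZl a x y : B (a *: x) y = a * B x y. Proof. exact: linearZl_LR. Qed.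
Lemma symformZr a x y : B y (a *: x) = a * B y x. Proof. exact: linearZr_LR. Qed.

Lemma symform_suml (I : finType) (F : I -> V) y :
  B (\sum_i F i) y = \sum_i B (F i) y.
Proof. by elim/big_rec2: _ => [|i a b _ <-]; rewrite ?symform0l ?symformDl. Qed.
Lemma symform_sumr (I : finType) (F : I -> V) y :
  B y (\sum_i F i) = \sum_i B y (F i).
Proof. by rewrite symformC symform_suml; apply: eq_bigr => i _; rewrite symformC. Qed.

Definition symformE := (symformDl, symformDr, symformNl, symformNr, symformZl, symformZr).

Lemma nondegenerateP :
  reflect (forall x, (forall y, B x y = 0) -> x = 0) (nondegenerate B).
Proof.
apply: (iffP eqP) => [rad0 x x0|rad0].
  by apply/eqP; rewrite -memv0 -rad0; apply/mem_orthovP => y _; apply: x0.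
apply/eqP; rewrite -subv0; apply/subvP => x /mem_orthovP x0.
by rewrite (rad0 x) ?mem0v // => y; apply: x0; rewrite memvf.
Qed.

(** The degenerate case of the Cauchy-Schwarz inequality. *)
Lemma psd_null_orthogonal (P : {vspace V}) x y :
    (forall z, z \in P -> 0 <= B z z) -> x \in P -> y \in P ->
  B x x = 0 -> B x y = 0.
Proof.
move=> psd xP yP x0; apply/eqP; apply/negPn/negP => xy0.
(* This t makes the square of y + t x equal to -1. *)
pose t := - (B y y + 1) / (2 * B x y).
have /psd : y + t *: x \in P by rewrite memvD ?memvZ.
have -> : B (y + t *: x) (y + t *: x) = - 1.
  by rewrite !symformE x0 (symformC y x) /t; field.
by rewrite lerNr oppr0 ler10.
Qed.

Lemma psd_nondegenerate_riemannian :
  nondegenerate B -> (forall x, 0 <= B x x) -> riemannian B.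
Proof.
move=> /nondegenerateP nd psd x x0; rewrite lt_neqAle psd andbT eq_sym.
apply: contra_neq x0 => x0; apply: nd => y.
by apply: (@psd_null_orthogonal fullv); rewrite ?memvf.
Qed.

Lemma negdef_plane u x : B u u < 0 -> B x x < 0 -> B u x = 0 ->
  negdef_on B (<[u]> + <[x]>)%VS /\ \dim (<[u]> + <[x]>) = 2%N.
Proof.
move=> u0 x0 ux.
have un0 : u != 0 by apply: contraTneq u0 => ->; rewrite symform0l ltxx.
have xn0 : x != 0 by apply: contraTneq x0 => ->; rewrite symform0l ltxx.
split=> [z /memv_addP[_ /vlineP[a ->] [_ /vlineP[b ->] ->]]|].
  have [-> |a0] := eqVneq a 0.
    have [-> |b0 _] := eqVneq b 0; first by rewrite !scale0r addr0 eqxx.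
    by rewrite scale0r add0r !symformE mulrA nmulr_llt0 // -expr2 exprn_even_gt0.
  move=> _; rewrite !symformE (symformC x u) ux.
  have := sqr_ge0 b; have : 0 < a ^+ 2 by rewrite exprn_even_gt0.
  nra.
rewrite dimv_disjoint_sum ?dim_vline ?un0 ?xn0 //.
apply/eqP; rewrite -subv0; apply/subvP => z /memv_capP[/vlineP[a zu] /vlineP[b zx]].
have : a * B u u = 0 by rewrite -symformZl -zu zx symformZl symformC ux mulr0.
by move/eqP; rewrite mulf_eq0 (lt_eqF u0) orbF => /eqP a0; rewrite zu a0 scale0r mem0v.
Qed.

(** The geometric form of the signature that all later arguments use: the
    orthogonal complement of a timelike vector is positive definite. *)
Lemma lorentzianP : lorentzian B <->
  (exists u, B u u < 0) /\
  (forall u x, B u u < 0 -> B u x = 0 -> x != 0 -> 0 < B x x).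
Proof.
split=> [[/nondegenerateP nd [[U negU dimU] maxU]]|[[u u0] spacelike]].
  split=> [|u x u0 ux].
    have U0 : U != 0%VS by rewrite -dimv_eq0 dimU.
    by exists (vpick U); apply: negU; rewrite ?memv_pick ?vpick0.
  have psd y : y \in orthov B <[u]> -> 0 <= B y y.
    rewrite mem_orthov1 symformC leNgt => /eqP uy; apply/negP => y0.
    have [neg dim2] := negdef_plane u0 y0 uy.
    by have := maxU _ neg; rewrite dim2.
  have xu : x \in orthov B <[u]> by rewrite mem_orthov1 symformC ux.
  move=> xn0; rewrite lt_neqAle psd // andbT eq_sym; apply: contra_neq xn0 => x0.
  apply: nd => y.
  have -> : y = (y - (B u y / B u u) *: u) + (B u y / B u u) *: u by rewrite subrK.
  rewrite symformDr symformZr (symformC x u) ux mulr0 addr0.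
  apply: (psd_null_orthogonal psd) => //.
  by rewrite mem_orthov1 symformC !symformE divfK ?subrr // lt_eqF.
have un0 : u != 0 by apply: contraTneq u0 => ->; rewrite symform0l ltxx.
split.
  apply/nondegenerateP => x x0; apply/eqP/negPn/negP => xn0.
  by have := spacelike u x u0; rewrite symformC !x0 ltxx => /(_ erefl xn0).
split.
  exists <[u]>%VS; last by rewrite dim_vline un0.
  move=> _ /vlineP[a ->]; rewrite scaler_eq0 (negPf un0) orbF => a0.
  by rewrite !symformE mulrA nmulr_llt0 // -expr2 exprn_even_gt0.
move=> U negU; rewrite leqNgt; apply/negP => dimU.
have : (U :&: orthov B <[u]>)%VS != 0%VS.
  rewrite -dimv_eq0 -lt0n; apply: leq_trans (leq_dim_orthov1 B u U).
  by case: (\dim U) dimU => [|[]].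
rewrite -vpick0; set x := vpick _ => xn0.
have /memv_capP[xU] : x \in (U :&: orthov B <[u]>)%VS by apply: memv_pick.
rewrite mem_orthov1 symformC => /eqP ux.
by have := lt_trans (spacelike u x u0 ux xn0) (negU x xU xn0); rewrite ltxx.
Qed.

(** The complement is the kernel of the pairing with a basis of U. *)
Lemma dim_orthov_ge U : (\dim {:V} <= \dim U + \dim (orthov B U))%N.
Proof.
pose f (x : V) : 'rV[R]_(\dim U) := \row_i B (vbasis U)`_i x.
have f_lin : linear f.
  by move=> a x y; apply/rowP => i; rewrite !mxE !symformE.
pose fL := GRing.isLinear.Build _ _ _ _ f f_lin.
pose F : {linear V -> 'rV[R]_(\dim U)} := HB.pack f fL.
have kerF : (lker (linfun F) <= orthov B U)%VS.
  apply/subvP => x; rewrite memv_ker lfunE => /eqP Fx.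
  apply/mem_orthovP => y /coord_vbasis ->; rewrite symform_sumr big1 // => i _.
  rewrite symformZr symformC; have := congr1 (fun r : 'rV_ _ => r 0 i) Fx.
  by rewrite !mxE => ->; rewrite mulr0.
have := limg_ker_dim (linfun F) fullv; rewrite capfv => <-.
rewrite addnC leq_add ?dimvS //.
apply: leq_trans (dimvS (subvf _)) _; by rewrite dimvf /dim /= mul1n.
Qed.

Lemma addv_orthov U : (U :&: orthov B U = 0)%VS -> (U + orthov B U)%VS = fullv.
Proof.
move=> U0; apply/eqP; rewrite eqEdim subvf /= dimv_disjoint_sum //.
exact: dim_orthov_ge.
Qed.

Lemma addv_orthov_in U W : (W <= U)%VS -> (W :&: orthov B W = 0)%VS ->
  (W + (U :&: orthov B W))%VS = U.
Proof.
move=> WU /addv_orthov full; apply/eqP; rewrite eqEsubv subv_add WU capvSl /=.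
apply/subvP => x xU; have : x \in (W + orthov B W)%VS by rewrite full memvf.
case/memv_addP => w wW [w' w'W xE]; apply/memv_addP; exists w => //.
exists w' => //; rewrite memv_cap w'W andbT.
have -> : w' = x - w by rewrite xE [w + _]addrC addrK.
by rewrite memvB // (subvP WU).
Qed.

(** Gram-Schmidt, splitting off one unit vector at a time. *)
Lemma orthonormal_basis_of U : (forall x, x \in U -> x != 0 -> 0 < B x x) ->
  exists b : 'I_(\dim U) -> V,
    [/\ forall i, b i \in U, forall i j, B (b i) (b j) = (i == j)%:R
      & forall x, x \in U -> x = \sum_i B (b i) x *: b i].
Proof.
move: {2}(\dim U) (erefl (\dim U)) => n; elim: n U => [|n IHn] U dimU pos.
  move/eqP: (dimU); rewrite dimv_eq0 => /eqP U0.
  exists (fun=> 0); split=> [i|i|x].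
  - by rewrite mem0v.
  - by exfalso; case: i => i; rewrite dimU.
  - by rewrite U0 memv0 big1 => [/eqP|i _]; rewrite ?scaler0.
have [x xU x1] : exists2 x, x \in U & B x x = 1.
  have Un0 : vpick U != 0 by rewrite vpick0 -dimv_eq0 dimU.
  have qpos := pos _ (memv_pick U) Un0.
  exists ((Num.sqrt (B (vpick U) (vpick U)))^-1 *: vpick U).
    by rewrite memvZ ?memv_pick.
  rewrite !symformE mulrA -expr2 exprVn sqr_sqrtr ?ltW // mulVf //.
  by rewrite gt_eqF.
pose U' := (U :&: orthov B <[x]>)%VS.
have dimU' : \dim U' = n.
  rewrite -eq_dim_orthov1 ?dimU //; apply/mem_orthovPn.
  by exists x => //; rewrite x1 oner_eq0.
have [|b' [b'U b'1 b'E]] := IHn U' dimU'.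
  by move=> y /memv_capP[yU _]; apply: pos.
rewrite dimU' in b' b'U b'1 b'E; rewrite dimU.
have xb' i : B x (b' i) = 0.
  by have /memv_capP[_] := b'U i; rewrite mem_orthov1 symformC => /eqP.
exists (fun i => if unlift ord0 i is Some j then b' j else x); split.
- by move=> i; case: unliftP => [j _|_] //; have /memv_capP[] := b'U j.
- move=> i j; case: unliftP => [i' ->|->]; case: unliftP => [j' ->|->].
  + by rewrite b'1 (inj_eq lift_inj).
  + by rewrite symformC xb' eq_sym (negPf (neq_lift _ _)).
  + by rewrite xb' (negPf (neq_lift _ _)).
  + by rewrite x1 eqxx.
- move=> y yU; rewrite big_ord_recl unlift_none.
  under eq_bigr => i _ do rewrite liftK.
  have y'U : y - B x y *: x \in U'.
    apply/memv_capP; split; first by rewrite memvB ?memvZ.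
    by rewrite mem_orthov1 !symformE x1 mulr1 symformC subrr.
  rewrite -[LHS](subrK (B x y *: x)) addrC; congr (_ + _).
  rewrite {1}(b'E _ y'U); apply: eq_bigr => i _.
  by rewrite !symformE [B (b' i) x]symformC xb' mulr0 subr0.
Qed.

Lemma orthonormal_basis : riemannian B ->
  exists b : 'I_(\dim {:V}) -> V,
    (forall i j, B (b i) (b j) = (i == j)%:R) /\
    (forall x, x = \sum_i B (b i) x *: b i).
Proof.
move=> pos; have [x _|b [_ b1 bE]] := @orthonormal_basis_of fullv.
  exact: pos.
by exists b; split=> // x; rewrite -bE ?memvf.
Qed.

Section Lorentzian.
Hypothesis spacelike :
  forall u x, B u u < 0 -> B u x = 0 -> x != 0 -> 0 < B x x.
Variable u : V.
Hypothesis u_timelike : B u u < 0.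

Lemma causal_orthogonal_timelike x : B x x <= 0 -> B u x = 0 -> x = 0.
Proof.
move=> x0 ux; apply/eqP/negPn/negP => xn0.
by have := spacelike u_timelike ux xn0; rewrite ltNge x0.
Qed.

(** Sliding y along the null line of x, which is orthogonal to y, does not
    change its square; as x is not orthogonal to u, this can bring y into the
    definite space orthogonal to u. The next two lemmas follow. *)
Lemma orthogonal_null_projection x y : x != 0 -> B x x = 0 -> B x y = 0 ->
  exists c, B u (y - c *: x) = 0 /\ B (y - c *: x) (y - c *: x) = B y y.
Proof.
move=> xn0 x0 xy; have ux : B u x != 0.
  by apply: contra_neq xn0; apply: causal_orthogonal_timelike; rewrite x0.
exists (B u y / B u x); split; first by rewrite !symformE divfK // subrr.
by rewrite !symformE x0 (symformC y x) xy; ring.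
Qed.

Lemma orthogonal_null_ge0 x y :
  x != 0 -> B x x = 0 -> B x y = 0 -> 0 <= B y y.
Proof.
move=> xn0 x0 xy; have [c [uz <-]] := orthogonal_null_projection xn0 x0 xy.
have [-> |zn0] := eqVneq (y - c *: x) 0; first by rewrite symform0l.
exact/ltW/(spacelike u_timelike).
Qed.

Lemma orthogonal_null_collinear x y :
  x != 0 -> B x x = 0 -> B x y = 0 -> B y y <= 0 -> exists c, y = c *: x.
Proof.
move=> xn0 x0 xy y0; have [c [uz zz]] := orthogonal_null_projection xn0 x0 xy.
exists c; apply/eqP; rewrite -subr_eq0; apply/eqP.
by apply: causal_orthogonal_timelike; rewrite // zz.
Qed.

End Lorentzian.

End SymmetricForms.

(** * Restrictions and skew maps *)

Section Restriction.
Variables (R : realType) (V : vectType R).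
Implicit Types (U : {vspace V}) (f : 'End(V)).

Definition restr U f : 'End(subvs_of U) :=
  (linfun (vsproj U) \o f \o linfun vsval)%VF.

Lemma restrE U f x : {in U, forall y, f y \in U} ->
  vsval (restr U f x) = f (vsval x).
Proof. by move=> fU; rewrite !comp_lfunE !lfunE /= vsprojK // fU ?subvsP. Qed.

Lemma dim_subvs U : dim (subvs_of U) = \dim U.
Proof. by []. Qed.

Lemma eigen_pair_restr U f a b x y : {in U, forall z, f z \in U} ->
  eigen_pair (restr U f) a b x y -> eigen_pair f a b (vsval x) (vsval y).
Proof.
move=> fU [xy0 fx fy]; split; last 2 first.
- by rewrite -restrE // fx linearB !linearZ.
- by rewrite -restrE // fy linearD !linearZ.
by move: xy0; rewrite -!(inj_eq (@subvs_inj _ _ U)) !linear0.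
Qed.

Lemma eigen_pair_in U f : U != 0%VS -> {in U, forall z, f z \in U} ->
  exists a b x y, [/\ x \in U, y \in U & eigen_pair f a b x y].
Proof.
move=> U0 fU; have [|a [b [x [y xy]]]] := eigen_pair_exists (restr U f).
  by rewrite dim_subvs lt0n dimv_eq0.
exists a, b, (vsval x), (vsval y); split; rewrite ?subvsP //.
exact: eigen_pair_restr.
Qed.

Lemma minimal_subspace (P : {vspace V} -> Prop) U : P U ->
  exists W, [/\ P W, (W <= U)%VS
             & forall W', P W' -> (W' <= W)%VS -> W' = W].
Proof.
move: {2}(\dim U).+1 (ltnSn (\dim U)) => n; elim: n U => // n IHn U.
rewrite ltnS => dimU PU.
have [[W [PW WU WnU]]|min] := pselect (exists W, [/\ P W, (W <= U)%VS & W <> U]).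
  have [|W' [PW' W'W min]] := IHn W _ PW.
    apply: leq_trans dimU; rewrite ltn_neqAle dimvS // andbT.
    by apply/negP => /eqP dimE; apply/WnU/eqP; rewrite eqEdim WU dimE /=.
  by exists W'; split=> //; apply: subv_trans WU.
exists U; split=> // W PW WU; apply: contrapT => WnU.
by apply: min; exists W.
Qed.

End Restriction.

Section SkewMaps.
Variables (R : realType) (V : vectType R) (B : {symmetric V}) (f : 'End(V)).
Hypothesis f_skew : in_so B f.

Lemma skew_self x : B (f x) x = 0.
Proof. have := f_skew x x; rewrite (symformC _ x (f x)); lra. Qed.

(** Skewness makes the eigenvalue l = a + i b satisfy (l + l) <w, w> = 0 for the
    bilinear square of the eigenvector w, and (l + conj l) <w, conj w> = 0. Both
    factors are nonzero when a != 0, so both products vanish; they encode the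
    three real products of x and y. *)
Lemma skew_eigen_pair_null (a b : R) x y : a != 0 ->
  f x = a *: x - b *: y -> f y = b *: x + a *: y ->
  [/\ B x x = 0, B y y = 0 & B x y = 0].
Proof.
move=> a0 fx fy; have := skew_self x; have := skew_self y; have := f_skew x y.
rewrite fx fy !symformE (symformC _ y x) => xy yy xx.
have xy0 : B x y = 0.
  have : 2 * (a ^+ 2 + b ^+ 2) * B x y = 0.
    transitivity (a * ((a * B x y - b * B y y) + (b * B x x + a * B x y))
      + b * (b * B x y + a * B y y) - b * (a * B x x - b * B x y)); first by ring.
    by rewrite xy addNr yy xx !mulr0 addr0 subr0.
  move/eqP; rewrite !mulf_eq0 pnatr_eq0 /= => /orP[|/eqP //].
  by rewrite paddr_eq0 ?sqr_ge0 // sqrf_eq0 (negPf a0).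
move: xx yy; rewrite xy0 !mulr0 oppr0 addr0 add0r => xx yy; split=> //.
  by move/eqP: xx; rewrite mulf_eq0 (negPf a0) => /eqP.
by move/eqP: yy; rewrite mulf_eq0 (negPf a0) => /eqP.
Qed.

Lemma skew_eigen_pair_imaginary (P : {vspace V}) (a b : R) x y :
  (forall z, z \in P -> z != 0 -> 0 < B z z) -> x \in P -> y \in P ->
  eigen_pair f a b x y -> a = 0.
Proof.
move=> pos xP yP [xy0 fx fy]; have := skew_self x; have := skew_self y.
rewrite fx fy !symformE (symformC _ y x) => yy xx.
have ge0 z : z \in P -> 0 <= B z z.
  by move=> zP; have [->|/pos/ltW->//] := eqVneq z 0; rewrite symform0l.
have : a * (B x x + B y y) = 0.
  transitivity ((a * B x x - b * B x y) + (b * B x y + a * B y y)); first by ring.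
  by rewrite xx yy addr0.
move/eqP; rewrite mulf_eq0 paddr_eq0 ?ge0 // => /orP[/eqP //|/andP[xx0 yy0]].
by case/orP: xy0 => [/(pos x xP)|/(pos y yP)]; rewrite ?(eqP xx0) ?(eqP yy0) ltxx.
Qed.

Hypothesis spacelike :
  forall u x, B u u < 0 -> B u x = 0 -> x != 0 -> 0 < B x x.
Variable u : V.
Hypothesis u_timelike : B u u < 0.

(** The vectors x and y are null and orthogonal, hence collinear, so the plane
    they should span is a line and the eigenvalue is real. *)
Lemma skew_eigen_pair_real (a b : R) x y :
  a != 0 -> eigen_pair f a b x y -> exists2 e, e != 0 & f e = a *: e.
Proof.
wlog x0 : b x y / x != 0.
  move=> H a0 xy; have [x0|] := eqVneq x 0; last by move/H; apply; eassumption.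
  subst x; case: xy; rewrite eqxx /= => y0 fx fy.
  apply: (H (- b) y 0) => //; split; rewrite ?y0 //.
    by rewrite fy scaleNr opprK addrC.
  by rewrite fx scaleNr addrC.
move=> a0 [_ fx fy]; have [xx yy xy] := skew_eigen_pair_null a0 fx fy.
have [|c yE] := orthogonal_null_collinear spacelike u_timelike x0 xx xy.
  by rewrite yy.
have : b *: x + a *: y = c *: (a *: x - b *: y) by rewrite -fx -fy yE linearZ.
move/eqP; rewrite yE -subr_eq0 scalerBr !scalerA -scalerBl -!scalerDl -scalerBl.
rewrite scaler_eq0 (negPf x0) orbF => /eqP bc.
have : b * (1 + c ^+ 2) = 0 by rewrite -bc; ring.
move/eqP; rewrite mulf_eq0 orbC gt_eqF ?ltr_wpDr ?sqr_ge0 //= => /eqP b0.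
by exists x => //; rewrite fx b0 scale0r subr0.
Qed.

End SkewMaps.

(** * Invariant subspaces of the representation *)

Section Representation.
Variables (R : realType) (g : lieAlgType R) (v : vectType R) (D : dataSet g v).
Notation A := (rho D).
Notation B := (metric_v D).
Notation Bg := (metric_g D).
Implicit Types (U W E : {vspace v}) (x y z : v) (X Y Z : g).

Lemma rho_skew Z x y : B (A Z x) y = - B x (A Z y).
Proof. exact: rho_so. Qed.

Lemma rho_self Z x : B x (A Z x) = 0.
Proof. by rewrite symformC; apply: skew_self (@rho_so _ _ _ D Z) x. Qed.

Lemma rho_lieE X Y x : A (lie X Y) x = A X (A Y x) - A Y (A X x).
Proof. by rewrite rho_lie add_lfunE opp_lfunE !comp_lfunE. Qed.

Lemma rho_center Z X x : in_center Z -> A Z (A X x) = A X (A Z x).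
Proof.
move=> /(_ X) ZX; apply/eqP; rewrite -subr_eq0 -rho_lieE ZX linear0.
by rewrite zero_lfunE.
Qed.

Lemma rep_invariantP U :
  rep_invariant D U <-> (forall Z x, x \in U -> A Z x \in U).
Proof.
split=> [inv Z x xU|inv Z]; first by apply: (subvP (inv Z)); apply: memv_img.
by apply/subvP => _ /memv_imgP[x xU ->]; apply: inv.
Qed.

Lemma rep_invariant_cap U W :
  rep_invariant D U -> rep_invariant D W -> rep_invariant D (U :&: W)%VS.
Proof.
move=> /rep_invariantP iU /rep_invariantP iW; apply/rep_invariantP => Z x.
by move=> /memv_capP[xU xW]; rewrite memv_cap iU ?iW.
Qed.

Lemma rep_invariant_orthov U : rep_invariant D U -> rep_invariant D (orthov B U).
Proof.
move=> /rep_invariantP iU; apply/rep_invariantP => Z x /mem_orthovP xU.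
by apply/mem_orthovP => y yU; rewrite rho_skew xU ?oppr0 ?iU.
Qed.

Lemma rep_invariant_lineP x :
  rep_invariant D <[x]>%VS <-> (forall Z, exists c, A Z x = c *: x).
Proof.
split=> [/rep_invariantP inv Z|inv].
  by have /vlineP[c ->] := inv Z x (memv_line x); exists c.
apply/rep_invariantP => Z _ /vlineP[a ->]; have [c xE] := inv Z.
by rewrite linearZ /= xE !memvZ ?memv_line.
Qed.

Lemma rep_irreducible_line x : x != 0 -> rep_invariant D <[x]>%VS ->
  rep_irreducible D <[x]>%VS.
Proof.
move=> x0 inv; split=> //; first by rewrite -dimv_eq0 dim_vline x0.
move=> W _ Wx; have [->|W0] := eqVneq W 0%VS; [by left|right].
by apply/eqP; rewrite eqEdim Wx dim_vline x0 lt0n dimv_eq0.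
Qed.

(** Schur's lemma: the kernel of an operator commuting with the representation
    is invariant. *)
Lemma irreducible_ker E (T : 'End(v)) x : rep_irreducible D E ->
    (forall Z z, T (A Z z) = A Z (T z)) -> x \in E -> x != 0 -> T x = 0 ->
  forall z, z \in E -> T z = 0.
Proof.
move=> [iE _ irr] TA xE x0 Tx0.
have iK : rep_invariant D (lker T).
  apply/rep_invariantP => Z z; rewrite !memv_ker TA => /eqP ->.
  by rewrite linear0.
have xK : x \in (E :&: lker T)%VS by rewrite memv_cap xE memv_ker Tx0 eqxx.
have [K0|KE] := irr _ (rep_invariant_cap iE iK) (capvSl _ _).
  by move: x0; rewrite K0 memv0 in xK; rewrite xK.
by move=> z; rewrite -KE => /memv_capP[_]; rewrite memv_ker => /eqP.
Qed.

(** If u is timelike in v, then (0, u) is timelike in g + v, and every (X, 0)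
    is orthogonal to it. *)
Lemma metric_g_riemannian :
  lorentzian_dataSet D -> lorentzian B -> riemannian Bg.
Proof.
move=> /lorentzianP[_ spacelike] /lorentzianP[[u u0] _].
apply: psd_nondegenerate_riemannian; first exact: metric_g_nondeg.
move=> X; have [->|X0] := eqVneq X 0; first by rewrite symform0l.
have := spacelike (0, u) (X, 0); rewrite /= /sum_form /= !symform0l !symform0r.
rewrite add0r !addr0 => /(_ u0 erefl) H; apply/ltW/H.
by apply: contra_neq X0 => -[].
Qed.

(** * Boosts and their eigenlines *)

Section LorentzianRepresentation.
Hypothesis posg : riemannian Bg.
Hypothesis spacelike :
  forall u x, B u u < 0 -> B u x = 0 -> x != 0 -> 0 < B x x.
Variable u : v.
Hypothesis u_timelike : B u u < 0.

Lemma boost_null Z (a : R) e : a != 0 -> A Z e = a *: e -> B e e = 0.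
Proof.
move=> a0 Ze; have := rho_self Z e; rewrite Ze symformZr => /eqP.
by rewrite mulf_eq0 (negPf a0) => /eqP.
Qed.

(** Let K be the space of the X with A X e in the line of e; the claim is that K
    is all of g. K and its orthogonal complement are stable under ad Z. On the
    complement ad Z, skew for a definite form, has a pair X, Y with an imaginary
    eigenvalue; then A X e and A Y e satisfy the equations of a pair for A Z
    whose eigenvalue has real part a. They are thus null, and they are orthogonal
    to e by skewness, so X and Y lie in K, although K meets its complement
    only in 0. *)
Lemma boost_line_invariant Z (a : R) e :
  a != 0 -> e != 0 -> A Z e = a *: e -> rep_invariant D <[e]>%VS.
Proof.
move=> a0 e0 Ze; have ee := boost_null a0 Ze.
have phi_lin : linear (fun X : g => A X e).
  by move=> c X Y; rewrite linearP add_lfunE scale_lfunE.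
pose phiL := GRing.isLinear.Build _ _ _ _ _ phi_lin.
pose phi : {linear g -> v} := HB.pack (fun X : g => A X e) phiL.
have ad_lin : linear (lie Z) by apply: lie_linearr.
pose adL := GRing.isLinear.Build _ _ _ _ _ ad_lin.
pose ad : {linear g -> g} := HB.pack (lie Z) adL.
pose K := (linfun phi @^-1: <[e]>)%VS.
have memK X : (X \in K) = (A X e \in <[e]>%VS) by rewrite -memv_preim lfunE.
have adK X : X \in K -> lie Z X \in K.
  rewrite !memK => /vlineP[c Xe].
  by rewrite rho_lieE Xe Ze !linearZ /= Ze Xe scalerN !scalerA [c * a]mulrC subrr mem0v.
have ad_skew : in_so Bg (linfun ad).
  by move=> X Y; rewrite !lfunE; apply: metric_g_adinv.
have adK' : {in orthov Bg K, forall X, linfun ad X \in orthov Bg K}.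
  move=> X /mem_orthovP XK; apply/mem_orthovP => Y YK.
  by rewrite ad_skew lfunE XK ?oppr0 // adK.
have KK' X : X \in K -> X \in orthov Bg K -> X = 0.
  move=> XK /mem_orthovP/(_ X XK) X0; apply/eqP/negPn/negP => /posg.
  by rewrite X0 ltxx.
have [K'0|K'0] := eqVneq (orthov Bg K) 0%VS.
  have Kfull : K = fullv.
    apply/eqP; rewrite eqEdim subvf /=.
    by have := dim_orthov_ge Bg K; rewrite K'0 dimv0 addn0.
  apply/rep_invariant_lineP => X; apply/vlineP.
  by rewrite -memK Kfull memvf.
have [c [b [X [Y [XK' YK' XY]]]]] := eigen_pair_in K'0 adK'.
have c0 : c = 0.
  by apply: (skew_eigen_pair_imaginary ad_skew _ XK' YK' XY) => X' _; apply: posg.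
case: XY => XY0; rewrite c0 !scale0r add0r addr0 !lfunE /= => adX adY.
have AZe X' : A X' (A Z e) = a *: A X' e by rewrite Ze linearZ.
have Zx : A Z (A X e) = a *: A X e - b *: A Y e.
  have := rho_lieE Z X e; rewrite adX AZe => /eqP.
  rewrite eq_sym subr_eq => /eqP ->.
  by rewrite linearN opp_lfunE linearZ scale_lfunE addrC.
have Zy : A Z (A Y e) = b *: A X e + a *: A Y e.
  have := rho_lieE Z Y e; rewrite adY AZe => /eqP.
  rewrite eq_sym subr_eq => /eqP ->.
  by rewrite linearZ scale_lfunE.
have [xx yy _] := skew_eigen_pair_null (@rho_so _ _ _ D Z) a0 Zx Zy.
have inK X' : B (A X' e) (A X' e) = 0 -> X' \in K.
  move=> XX; have [|c' Xe] := orthogonal_null_collinear spacelike u_timelike e0 ee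
    (rho_self X' e); first by rewrite XX.
  by rewrite memK Xe memvZ ?memv_line.
by move: XY0; rewrite (KK' X (inK _ xx) XK') (KK' Y (inK _ yy) YK') eqxx.
Qed.

(** If A Z + a were injective it would be onto, but by skewness its image is
    orthogonal to e. *)
Lemma opposite_boost_vector Z (a : R) e : a != 0 -> e != 0 -> A Z e = a *: e ->
  exists f, [/\ f != 0, A Z f = - a *: f & B e f != 0].
Proof.
move=> a0 e0 Ze; pose h := A Z + a *: \1%VF.
have hE x : h x = A Z x + a *: x.
  by rewrite add_lfunE scale_lfunE id_lfunE.
have ker0 : lker h != 0%VS.
  apply/negP => ker0; move/negP: e0; apply; apply/eqP.
  have /nondegenerateP := metric_v_nondeg D; apply=> w.
  rewrite -(lker0_lfunVK ker0 w) hE symformDr symformZr.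
  move: (h^-1%VF w) => t.
  by rewrite -[B e (A Z t)]opprK -rho_skew Ze symformZl addNr.
exists (vpick (lker h)); set f := vpick _.
have f0 : f != 0 by rewrite vpick0.
have Zf : A Z f = - a *: f.
  apply/eqP; rewrite scaleNr -addr_eq0 -hE -memv_ker; exact: memv_pick.
split=> //; apply: contra_neq f0 => ef.
have ff : B f f = 0 by apply: (@boost_null Z (- a)); rewrite ?oppr_eq0.
have [|c fE] := orthogonal_null_collinear spacelike u_timelike e0
  (boost_null a0 Ze) ef; first by rewrite ff.
move: Zf; rewrite fE linearZ /= Ze !scalerA => /eqP; rewrite -subr_eq0 -scalerBl.
rewrite scaler_eq0 (negPf e0) orbF mulNr opprK [a * c]mulrC -mulr2n.
by rewrite mulrn_eq0 mulf_eq0 (negPf a0) orbF => /eqP ->; rewrite scale0r.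
Qed.

(** * Lorentzian subspaces in the absence of boosts *)

Section NoBoost.
Hypothesis no_boost : forall Z (a : R) e, e != 0 -> A Z e = a *: e -> a = 0.

Lemma no_null_line e : e != 0 -> B e e = 0 ->
  ~ (forall Z, exists c, A Z e = c *: e).
Proof.
move=> e0 ee inv; move/eqP: (e0); apply; apply: (rho_no_trivial (d := D)) => Z.
by have [c Ze] := inv Z; rewrite Ze (no_boost e0 Ze) scale0r.
Qed.

(** The radical is invariant and consists of mutually orthogonal null vectors,
    so a nonzero one would span an invariant null line. *)
Lemma invariant_radical0 W : rep_invariant D W -> (W :&: orthov B W = 0)%VS.
Proof.
move=> iW; apply/eqP/negPn/negP; rewrite -vpick0; set e := vpick _ => e0.
have rad x y : x \in (W :&: orthov B W)%VS -> y \in (W :&: orthov B W)%VS ->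
    B x y = 0.
  by move=> /memv_capP[_ /mem_orthovP xW] /memv_capP[yW _]; apply: xW.
have eW : e \in (W :&: orthov B W)%VS by apply: memv_pick.
apply: (no_null_line e0) => [|Z]; first exact: rad.
have /rep_invariantP iR := rep_invariant_cap iW (rep_invariant_orthov iW).
apply: (orthogonal_null_collinear spacelike u_timelike e0); rewrite ?rad ?iR //.
Qed.

(** Take E minimal among the invariant subspaces that have a timelike vector.
    For an invariant W inside E, the space E is the orthogonal sum of W and its
    complement, and a timelike vector of E has a timelike component in one of
    the two, which is then all of E. *)
Lemma irreducible_lorentzian_subspace :
  exists2 E, rep_irreducible D E & exists2 w, w \in E & B w w < 0.
Proof.
pose P U := rep_invariant D U /\ exists2 w, w \in U & B w w < 0.
have [|E [[iE [w wE w0]] _ minE]] := @minimal_subspace _ _ P fullv.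
  by split; [move=> Z; apply: subvf | exists u; rewrite ?memvf].
exists E; last by exists w.
split=> [//||W iW WE].
  by apply: contraTneq w0 => E0; move: wE; rewrite E0 memv0 => /eqP ->; rewrite symform0l ltxx.
have iW' := rep_invariant_cap iE (rep_invariant_orthov iW).
have rad0 := invariant_radical0 iW; have sum := addv_orthov_in WE rad0.
have : w \in (W + (E :&: orthov B W))%VS by rewrite sum.
case/memv_addP=> [x xW [y yW' wxy]].
have xy : B x y = 0.
  by have /memv_capP[_ /mem_orthovP yW] := yW'; rewrite symformC yW.
have : B x x + B y y < 0.
  by move: w0; rewrite wxy !symformE (symformC _ y x) xy addr0 add0r.
have [x0 _|x0 xy0] := ltP (B x x) 0.
  by right; apply: minE => //; split=> //; exists x.
left; have y0 : B y y < 0 by lra.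
have E' : (E :&: orthov B W)%VS = E.
  by apply: (minE (E :&: orthov B W)%VS); rewrite ?capvSl //; split=> //; exists y.
apply/eqP; rewrite -subv0 -rad0 subv_cap subvv /=.
by apply: subv_trans WE _; rewrite -E' capvSr.
Qed.

End NoBoost.

(** * The Casimir operator and the existence of a boost *)

Section Casimir.
Variable b : 'I_(\dim {:g}) -> g.
Hypothesis b_orthonormal : forall i j, Bg (b i) (b j) = (i == j)%:R.
Hypothesis b_basis : forall X, X = \sum_i Bg (b i) X *: b i.

Definition casimir : 'End(v) := \sum_i (A (b i) \o A (b i))%VF.

Lemma casimirE x : casimir x = \sum_i A (b i) (A (b i) x).
Proof. by rewrite sum_lfunE; apply: eq_bigr => i _; rewrite comp_lfunE. Qed.

Lemma casimir_form x y : B (casimir x) y = - \sum_i B (A (b i) x) (A (b i) y).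
Proof.
rewrite casimirE symform_suml -sumrN; apply: eq_bigr => i _.
by rewrite rho_skew.
Qed.

Lemma casimir_sym x y : B (casimir x) y = B x (casimir y).
Proof.
rewrite casimir_form [RHS]symformC casimir_form; congr (- _).
by apply: eq_bigr => i _; rewrite symformC.
Qed.

(** Ad-invariance of the form says that the matrix c of ad X in an orthonormal
    basis is skew, while the sum of A (b i) A (b j) + A (b j) A (b i) that it
    multiplies is symmetric. *)
Lemma casimir_comm X x : casimir (A X x) = A X (casimir x).
Proof.
pose c i j := Bg (b j) (lie X (b i)).
have cN i j : c j i = - c i j.
  by rewrite /c symformC metric_g_adinv symformC.
have lieE i : A (lie X (b i)) = \sum_j c i j *: A (b j).
  by rewrite {1}(b_basis (lie X (b i))) linear_sum; apply: eq_bigr => j _; rewrite linearZ.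
have comm i y : A X (A (b i) y) = A (b i) (A X y) + \sum_j c i j *: A (b j) y.
  have := rho_lieE X (b i) y; rewrite lieE sum_lfunE => /eqP.
  rewrite eq_sym subr_eq addrC => /eqP ->; congr (_ + _).
  by apply: eq_bigr => j _; rewrite scale_lfunE.
rewrite !casimirE linear_sum /=.
under [RHS]eq_bigr => i _.
  rewrite comm comm linearD linear_sum /= -addrA.
  under [X in _ + (X + _)]eq_bigr => j _ do rewrite linearZ /=.
  over.
rewrite !big_split /= [X in _ + (_ + X)]exchange_big -big_split /=.
rewrite [X in _ + X]big1 ?addr0 // => i _.
rewrite -big_split big1 // => j _ /=.
by rewrite (cN i j) scaleNr subrr.
Qed.

Lemma rho_sum X x : A X x = \sum_i Bg (b i) X *: A (b i) x.
Proof.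
rewrite {1}(b_basis X) linear_sum sum_lfunE; apply: eq_bigr => i _.
by rewrite linearZ scale_lfunE.
Qed.

Lemma casimir_causal_le0 x : B x x <= 0 ->
  (forall i, 0 <= B (A (b i) x) (A (b i) x)) /\ B (casimir x) x <= 0.
Proof.
move=> xx; suff pos i : 0 <= B (A (b i) x) (A (b i) x).
  by split=> //; rewrite casimir_form oppr_le0 sumr_ge0.
have [->|x0] := eqVneq x 0; first by rewrite linear0 symform0l.
have [x_neg|] := ltP (B x x) 0.
  have [->|y0] := eqVneq (A (b i) x) 0; first by rewrite symform0l.
  exact/ltW/(spacelike x_neg (rho_self _ _)).
rewrite le_eqVlt ltNge xx orbF => /eqP /esym xx0.
exact: (orthogonal_null_ge0 spacelike u_timelike x0 xx0 (rho_self _ _)).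
Qed.

Hypothesis no_boost : forall Z (a : R) e, e != 0 -> A Z e = a *: e -> a = 0.

(** If all the A (b i) x are null, then they are multiples of x: for x timelike
    because they lie in a definite space, for x null by collinearity. Without
    boosts the factors vanish, and x spans a trivial subrepresentation. *)
Lemma casimir_causal_lt0 x : x != 0 -> B x x <= 0 -> B (casimir x) x < 0.
Proof.
move=> x0 xx; have [pos le0] := casimir_causal_le0 xx.
rewrite lt_neqAle le0 andbT; apply/eqP; rewrite casimir_form => /eqP.
rewrite oppr_eq0 => /eqP /psumr_eq0P zero.
have {}zero i : B (A (b i) x) (A (b i) x) = 0 by apply: zero.
have line i : exists c, A (b i) x = c *: x.
  have [x_neg|] := ltP (B x x) 0.
    exists 0; rewrite scale0r; apply: (causal_orthogonal_timelike spacelike x_neg).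
      by rewrite zero.
    exact: rho_self.
  rewrite le_eqVlt ltNge xx orbF => /eqP /esym xx0.
  apply: (orthogonal_null_collinear spacelike u_timelike x0 xx0 (rho_self _ _)).
  by rewrite zero.
have lineZ Z : A Z x = 0.
  rewrite rho_sum big1 // => i _; have [c bx] := line i.
  by rewrite bx (no_boost x0 bx) scale0r scaler0.
by move/eqP: x0; apply; apply: (rho_no_trivial (d := D)).
Qed.

(** By Schur's lemma the Casimir operator acts on E with a single eigenvalue
    a + i c, up to conjugation. A timelike vector shows a > 0 when c = 0. When
    c != 0, the operator J = C - a has J^2 = - c^2 and is symmetric, so it
    multiplies the form by - c^2. It then maps a null z to a null J z, and
    B (C z) z = B (J z) z has the sign opposite to that of
    B (C (J z)) (J z) = - c^2 B z (J z), although both must be negative. *)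
Lemma casimir_scalar E w : rep_irreducible D E -> w \in E -> B w w < 0 ->
  exists2 a, 0 < a & forall z, z \in E -> casimir z = a *: z.
Proof.
move=> irrE wE w0; have [iE E0 _] := irrE.
have invE Z : {in E, forall z, A Z z \in E} by move=> z; move/rep_invariantP: iE; apply.
have CE : {in E, forall z, casimir z \in E}.
  by move=> z zE; rewrite casimirE; apply: memv_suml => i _; rewrite !invE.
have [a [c [x [y [xE yE [xy0 Cx Cy]]]]]] := eigen_pair_in E0 CE.
have wn0 : w != 0 by apply: contraTneq w0 => ->; rewrite symform0l ltxx.
pose J := casimir - a *: \1%VF.
have JE z : J z = casimir z - a *: z.
  by rewrite add_lfunE opp_lfunE scale_lfunE id_lfunE.
have Jcomm Z z : J (A Z z) = A Z (J z).
  by rewrite !JE casimir_comm linearB /= [A Z (_ *: _)]linearZ.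
have Jsym p q : B (J p) q = B p (J q).
  by rewrite !JE !symformE casimir_sym.
have J_E z : z \in E -> J z \in E by move=> zE; rewrite JE memvB ?memvZ ?CE.
have Jx : J x = - (c *: y) by rewrite JE Cx addrAC subrr add0r.
have Jy : J y = c *: x by rewrite JE Cy addrK.
have [c0|c0] := eqVneq c 0.
  have Jker z : z \in E -> J z = 0.
    move=> zE; case/orP: xy0 => n0.
      by apply: (irreducible_ker irrE Jcomm xE n0); rewrite // Jx c0 scale0r oppr0.
    by apply: (irreducible_ker irrE Jcomm yE n0); rewrite // Jy c0 scale0r.
  have CaE z : z \in E -> casimir z = a *: z.
    by move=> /Jker/eqP; rewrite JE subr_eq0 => /eqP.
  exists a => //; have := casimir_causal_lt0 wn0 (ltW w0).
  by rewrite CaE // symformZl nmulr_llt0.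
pose T := (J \o J + c ^+ 2 *: \1)%VF.
have TE z : T z = J (J z) + c ^+ 2 *: z.
  by rewrite add_lfunE scale_lfunE id_lfunE comp_lfunE.
have Tcomm Z z : T (A Z z) = A Z (T z).
  by rewrite !TE !Jcomm linearD linearZ.
have JJ z : z \in E -> J (J z) = - (c ^+ 2 *: z).
  move=> zE; apply/eqP; rewrite -addr_eq0 -TE; apply/eqP.
  case/orP: xy0 => n0.
    apply: (irreducible_ker irrE Tcomm xE n0) => //.
    by rewrite TE Jx linearN linearZ /= Jy scalerA -expr2 addNr.
  apply: (irreducible_ker irrE Tcomm yE n0) => //.
  by rewrite TE Jy linearZ /= Jx scalerN scalerA -expr2 addNr.
have JJform p q : p \in E -> q \in E -> B (J p) (J q) = - (c ^+ 2 * B p q).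
  by move=> pE qE; rewrite Jsym JJ // !symformE.
have c2 : 0 < c ^+ 2 by rewrite exprn_even_gt0.
have [z [zE z0 zz]] : exists z, [/\ z \in E, z != 0 & B z z = 0].
  pose p := B w w; pose m := B w (J w); pose q := B (J w) (J w).
  have qE : q = - (c ^+ 2 * p) by rewrite /q JJform.
  have q0 : 0 < q by rewrite qE oppr_gt0 pmulr_rlt0.
  pose d := m ^+ 2 - p * q.
  have d0 : 0 <= d by rewrite /d; have := sqr_ge0 m; nra.
  (* s is a root of p s^2 + 2 m s + q, the square of s w + J w; its discriminant
     is positive because J turns the timelike w into a spacelike vector. *)
  pose s := (Num.sqrt d - m) / p.
  have ps : p * s = Num.sqrt d - m by rewrite mulrC divfK // lt_eqF.
  exists (s *: w + J w); split; first by rewrite memvD ?memvZ ?J_E.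
    apply: contraTneq q0 => /eqP; rewrite addrC addr_eq0 => /eqP Jw.
    rewrite -leNgt /q Jw -scaleNr !symformE mulrA -expr2.
    by rewrite mulr_ge0_le0 ?sqr_ge0 // ltW.
  rewrite !symformE (symformC _ (J w) w) -/p -/m -/q.
  have : p * (s * (s * p) + s * m + (s * m + q)) = 0.
    transitivity ((p * s) ^+ 2 + 2 * m * (p * s) + p * q); first by ring.
    rewrite ps; transitivity (Num.sqrt d ^+ 2 - m ^+ 2 + p * q); first by ring.
    by rewrite sqr_sqrtr // /d; ring.
  by move/eqP; rewrite mulf_eq0 lt_eqF //= => /eqP <-; ring.
have Jz0 : J z != 0.
  apply: contra_neq z0 => Jz; have := JJ z zE; rewrite Jz linear0 => /esym/eqP.
  by rewrite oppr_eq0 scaler_eq0 (gt_eqF c2) => /eqP.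
have Jzz : B (J z) (J z) = 0 by rewrite JJform // zz mulr0 oppr0.
have CJ t : B t t = 0 -> B (casimir t) t = B (J t) t.
  by move=> tt; rewrite JE !symformE tt mulr0 subr0.
have := casimir_causal_lt0 z0; rewrite zz CJ // => /(_ (lexx _)) lt1.
have := casimir_causal_lt0 Jz0; rewrite Jzz CJ // => /(_ (lexx _)).
rewrite JJ // symformNl symformZl symformC oppr_lt0 pmulr_rgt0 // => lt2.
by have := lt_trans lt1 lt2; rewrite ltxx.
Qed.

(** The trace argument: the Casimir operator of E is a positive scalar and a sum
    of squares of skew operators. *)
Lemma no_boost_absurd : False.
Proof.
have [E irrE [w wE w0]] := irreducible_lorentzian_subspace no_boost.
have [a a0 Ca] := casimir_scalar irrE wE w0; have [iE E0 _] := irrE.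
have invE Z : {in E, forall z, A Z z \in E}.
  by move=> z; move/rep_invariantP: iE; apply.
have [||i [c [d [x [y [c0 /(eigen_pair_restr (invE _)) xy]]]]]] :=
    @sum_squares_eigen_pair _ _ _ (fun i => restr E (A (b i))) a _ a0.
- by rewrite dim_subvs lt0n dimv_eq0.
- move=> z; apply: subvs_inj; rewrite linear_sum linearZ /= -Ca ?subvsP //.
  by rewrite casimirE; apply: eq_bigr => i _; rewrite !restrE.
have [e e0 be] := skew_eigen_pair_real (@rho_so _ _ _ D (b i)) spacelike
  u_timelike c0 xy.
by move/eqP: c0; apply; apply: no_boost be.
Qed.

End Casimir.

Lemma exists_boost :
  exists Z (a : R) e, [/\ a != 0, e != 0 & A Z e = a *: e].
Proof.
apply: contrapT => none; have [b [b1 bE]] := orthonormal_basis posg.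
apply: (no_boost_absurd bE) => Z a e e0 Ze; apply/eqP/negPn/negP => a0.
by apply: none; exists Z, a, e.
Qed.

End LorentzianRepresentation.

End Representation.

(** * Orthogonal families of subspaces *)

Section OrthogonalFamilies.
Variables (R : realType) (V : vectType R) (B : {symmetric V}).

Definition cons_family n (U0 : {vspace V}) (W : 'I_n -> {vspace V}) :
    'I_n.+1 -> {vspace V} :=
  fun i => if unlift ord0 i is Some j then W j else U0.

Lemma cons_family0 n U0 (W : 'I_n -> {vspace V}) : cons_family U0 W ord0 = U0.
Proof. by rewrite /cons_family unlift_none. Qed.

Lemma cons_familyS n U0 (W : 'I_n -> {vspace V}) i :
  cons_family U0 W (lift ord0 i) = W i.
Proof. by rewrite /cons_family liftK. Qed.

Lemma sum_cons_family n U0 (W : 'I_n -> {vspace V}) :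
  (\sum_i cons_family U0 W i = U0 + \sum_i W i)%VS.
Proof.
rewrite big_ord_recl cons_family0; congr (_ + _)%VS.
by apply: eq_bigr => i _; rewrite cons_familyS.
Qed.

Definition orthogonal_family n (W : 'I_n -> {vspace V}) : Prop :=
  forall i j, i != j -> (W i <= orthov B (W j))%VS.

Lemma orthogonal_cons_family n U0 (W : 'I_n -> {vspace V}) :
    orthogonal_family W -> (forall i, W i <= orthov B U0)%VS ->
  orthogonal_family (cons_family U0 W).
Proof.
move=> orthW W0 i j.
case: (unliftP ord0 i) => [i' ->|->]; case: (unliftP ord0 j) => [j' ->|->];
  rewrite ?cons_family0 ?cons_familyS ?(inj_eq lift_inj) ?eqxx // => ij.
- exact: orthW.
- by rewrite orthov_sym.
Qed.

Lemma orthogonal_directv n (W : 'I_n -> {vspace V}) : orthogonal_family W ->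
  (forall i, W i :&: orthov B (W i) = 0)%VS -> directv (\sum_i W i).
Proof.
move=> orthW rad0; apply/directv_sum_independent => x xW sum0 i _.
apply/eqP; rewrite -memv0 -(rad0 i) memv_cap xW //=.
apply/mem_orthovP => y yW.
have : B (\sum_j x j) y = 0 by rewrite sum0 symform0l.
rewrite symform_suml (bigD1 i) //= big1 ?addr0 // => j ji.
by have /orthovP/(_ _ _ (xW j isT) yW) := orthW _ _ ji.
Qed.

Lemma posdef_radical0 (U : {vspace V}) :
  (forall x, x \in U -> x != 0 -> 0 < B x x) -> (U :&: orthov B U = 0)%VS.
Proof.
move=> pos; apply/eqP; rewrite -subv0; apply/subvP => x /memv_capP[xU].
move=> /mem_orthovP/(_ x xU) x0; rewrite memv0; apply/negPn/negP => /(pos x xU).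
by rewrite x0 ltxx.
Qed.

End OrthogonalFamilies.

(** * Complex structures in even dimension *)

Section ComplexStructure.

(** The involution that exchanges 2 j and 2 j + 1. *)
Definition flip (k : nat) := if odd k then k.-1 else k.+1.

Lemma flipK : involutive flip.
Proof.
move=> k; rewrite /flip; case ok: (odd k); last by rewrite /= ok.
by case: k ok => //= k /negPf ->.
Qed.

Lemma odd_flip k : odd (flip k) = ~~ odd k.
Proof.
rewrite /flip; case ok: (odd k); last by rewrite /= ok.
by case: k ok => //= k /negPf.
Qed.

Lemma flip_lt n k : ~~ odd n -> (k < n)%N -> (flip k < n)%N.
Proof.
move=> en kn; rewrite /flip; case: ifP => [_|/negbT ok].
  by apply: leq_ltn_trans kn; apply: leq_pred.
rewrite ltn_neqAle kn andbT; apply: contraNneq en => <-.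
by rewrite /= ok.
Qed.

(** In an orthonormal basis, J sends the vectors numbered 2 j and 2 j + 1 to
    each other, with opposite signs. *)
Lemma even_complex_structure (R : realType) (V : vectType R) (B : {symmetric V}) :
    riemannian B -> ~~ odd (\dim {:V}) ->
  exists J : 'End(V), in_so B J /\ (J \o J = - \1)%VF.
Proof.
move=> pos even_n; have [b [b1 bE]] := orthonormal_basis pos.
pose s (i : 'I_(\dim {:V})) := Ordinal (flip_lt even_n (ltn_ord i)).
have sK : involutive s by move=> i; apply: val_inj; rewrite /= flipK.
pose J0 (x : V) := \sum_(i < \dim {:V}) (-1) ^+ odd i *: (B (b i) x *: b (s i)).
have J0_lin : linear J0.
  move=> a x y; rewrite /J0 scaler_sumr -big_split; apply: eq_bigr => i _ /=.
  by rewrite symformDr symformZr scalerDl -scalerA scalerDr !scalerA mulrCA mulrA.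
pose JL := GRing.isLinear.Build _ _ _ _ _ J0_lin.
pose J1 : {linear V -> V} := HB.pack J0 JL.
have J1E x : linfun J1 x = J0 x by rewrite lfunE.
have sE i : (-1) ^+ odd (s i) = - (-1) ^+ odd i :> R.
  by rewrite /= odd_flip; case: (odd i); rewrite ?expr0 ?expr1 ?opprK.
exists (linfun J1); split.
  move=> x y; rewrite !J1E /J0 symform_suml symform_sumr -sumrN.
  rewrite (reindex_inj (inv_inj sK)); apply: eq_bigr => i _ /=.
  rewrite !symformZl !symformZr sK -/(s i) sE.
  by rewrite (symformC _ (b (s i)) x); ring.
apply/lfunP => x; rewrite comp_lfunE opp_lfunE id_lfunE !J1E [in RHS](bE x).
rewrite /J0 -sumrN (reindex_inj (inv_inj sK)); apply: eq_bigr => i _ /=.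
rewrite sK -/(s i) sE symform_sumr (bigD1 i) //= big1 => [|j ji].
  rewrite !symformZr b1 eqxx mulr1 addr0 scalerA.
  by rewrite mulNr mulrA -expr2 sqrr_sign mul1r scaleNr.
by rewrite !symformZr b1 (inj_eq (inv_inj sK)) eq_sym (negPf ji) !mulr0.
Qed.

End ComplexStructure.

(** * Riemannian irreducible subspaces and the center *)

Section RiemannianPart.
Variables (R : realType) (g : lieAlgType R) (v : vectType R) (D : dataSet g v).
Notation A := (rho D).
Notation B := (metric_v D).
Implicit Types (U W E : {vspace v}) (x y z : v) (X Y Z : g).

Definition posdef_on U : Prop := forall x, x \in U -> x != 0 -> 0 < B x x.

Lemma posdef_onS U W : (W <= U)%VS -> posdef_on U -> posdef_on W.
Proof. by move=> /subvP WU pos x /WU; apply: pos. Qed.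

Lemma posdef_riemannian_sub U : posdef_on U -> riemannian_sub D U.
Proof.
move=> pos x x0; apply: pos; first exact: subvsP.
by move: x0; rewrite -(inj_eq (@subvs_inj _ _ U)) linear0.
Qed.

Lemma orthogonal_decomposition U : rep_invariant D U -> posdef_on U ->
  exists n (W : 'I_n -> {vspace v}),
    [/\ (\sum_i W i)%VS = U, orthogonal_family B W
      & forall i, rep_irreducible D (W i)].
Proof.
have [n] := ubnP (\dim U); elim: n U => // n IHn U dimU iU pos.
have [->|U0] := eqVneq U 0%VS.
  by exists 0%N, (fun=> 0%VS); split=> [|[]|[]] //; rewrite big_ord0.
pose P W := rep_invariant D W /\ W != 0%VS.
have [//|E [[iE E0] EU minE]] := @minimal_subspace _ _ P U.
have irrE : rep_irreducible D E.
  split=> // W iW WE; have [->|W0] := eqVneq W 0%VS; [by left|right].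
  exact: minE.
have rad0 := posdef_radical0 (posdef_onS EU pos).
have sumE := addv_orthov_in EU rad0; set U' := (U :&: orthov B E)%VS in sumE.
have U'U : (U' <= U)%VS by apply: capvSl.
have dimU' : (\dim U' < n)%N.
  rewrite -sumE dimv_disjoint_sum in dimU; last first.
    by apply/eqP; rewrite -subv0 -rad0 capvS // capvSr.
  apply: leq_trans (dimU : (_ <= n)%N); rewrite -[X in (X < _)%N]add0n ltn_add2r.
  by rewrite lt0n dimv_eq0.
have iU' : rep_invariant D U'.
  exact: rep_invariant_cap (rep_invariant_orthov iE).
have [k [W [sumW orthW irrW]]] := IHn U' dimU' iU' (posdef_onS U'U pos).
exists k.+1, (cons_family E W); split.
- by rewrite sum_cons_family sumW.
- apply: orthogonal_cons_family => // i; apply: subv_trans (capvSr U _).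
  by rewrite -/U' -sumW (sumv_sup i).
- by move=> i; case: (unliftP ord0 i) => [j ->|->]; rewrite ?cons_family0 ?cons_familyS.
Qed.

(** A symmetric operator has only real eigenvalues on a definite space, so
    Schur's lemma applies to S - a. *)
Lemma symmetric_commuting_scalar E (S : 'End(v)) :
    rep_irreducible D E -> posdef_on E -> {in E, forall x, S x \in E} ->
    (forall Z x, S (A Z x) = A Z (S x)) -> (forall x y, B (S x) y = B x (S y)) ->
  exists c, forall x, x \in E -> S x = c *: x.
Proof.
move=> irrE pos SE SA S_sym; have [_ E0 _] := irrE.
have [a [b [x [y [xE yE [xy0 Sx Sy]]]]]] := eigen_pair_in E0 SE.
have ge0 z : z \in E -> 0 <= B z z.
  by move=> zE; have [->|/(pos _ zE)/ltW->//] := eqVneq z 0; rewrite symform0l.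
have b0 : b = 0.
  have := S_sym x y; rewrite Sx Sy !symformE => xy.
  have : b * (B x x + B y y) = 0 by lra.
  move/eqP; rewrite mulf_eq0 paddr_eq0 ?ge0 // => /orP[/eqP //|/andP[xx0 yy0]].
  by case/orP: xy0 => [/(pos x xE)|/(pos y yE)]; rewrite ?(eqP xx0) ?(eqP yy0) ltxx.
exists a => z zE; pose T := S - a *: \1%VF.
have TE t : T t = S t - a *: t.
  by rewrite add_lfunE opp_lfunE scale_lfunE id_lfunE.
apply/eqP; rewrite -subr_eq0 -TE; apply/eqP.
have TA X t : T (A X t) = A X (T t).
  by rewrite !TE SA linearB /= [A X (_ *: _)]linearZ.
move: Sx Sy; rewrite b0 !scale0r subr0 add0r => Sx Sy.
case/orP: xy0 => n0.
  by apply: (irreducible_ker irrE TA xE n0); rewrite // TE Sx subrr.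
by apply: (irreducible_ker irrE TA yE n0); rewrite // TE Sy subrr.
Qed.

(** A product of commuting skew operators is symmetric. *)
Lemma center_square_scalar E Z X : rep_irreducible D E -> posdef_on E ->
  in_center Z -> in_center X ->
  exists c, forall x, x \in E -> A Z (A X x) = c *: x.
Proof.
move=> irrE pos cZ cX; have [/rep_invariantP iE _ _] := irrE.
have [|||c cE] := @symmetric_commuting_scalar E (A Z \o A X)%VF irrE pos.
- by move=> x xE; rewrite comp_lfunE !iE.
- by move=> Y x; rewrite !comp_lfunE (rho_center D _ _ cX) (rho_center D _ _ cZ).
- move=> x y; rewrite !comp_lfunE !rho_skew opprK.
  by rewrite (rho_center D _ _ cX).
by exists c => x xE; rewrite -cE // comp_lfunE.
Qed.

(** For X central, A Z A X = s on E; applying A Z once more turns the left side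
    into - t^2 A X and the right side into s A Z. The factor l depends only on X,
    so it can be chosen as a function of X. *)
Lemma center_complex_structure E Z : rep_irreducible D E -> posdef_on E ->
    in_center Z -> (exists2 x, x \in E & A Z x != 0) ->
  exists t, [/\ t != 0,
    (forall x, x \in E -> A Z (A Z x) = - t ^+ 2 *: x)
    & forall X, exists l, in_center X ->
        forall x, x \in E -> A X x = (l / t) *: A Z x].
Proof.
move=> irrE pos cZ [x0 x0E Zx0]; have [/rep_invariantP iE _ _] := irrE.
have [c cE] := center_square_scalar irrE pos cZ cZ.
have x0n0 : x0 != 0 by apply: contraNneq Zx0 => ->; rewrite linear0.
have c0 : c < 0.
  have : c * B x0 x0 < 0.
    by rewrite -symformZl -cE // rho_skew oppr_lt0 pos ?iE.
  by rewrite pmulr_llt0 ?pos.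
exists (Num.sqrt (- c)); set t := Num.sqrt _.
have t2 : - t ^+ 2 = c by rewrite sqr_sqrtr ?opprK // oppr_ge0 ltW.
have t0 : t != 0 by rewrite sqrtr_eq0 -ltNge oppr_gt0.
split=> // [x xE|X]; first by rewrite t2 cE.
have [cX|ncX] := pselect (in_center X); last by exists 0.
have [s sE] := center_square_scalar irrE pos cZ cX.
(* c = - t^2, and the factor t is divided out again in l / t. *)
exists (s / c * t) => _ x xE; rewrite mulfK //.
have := cE (A X x) (iE _ _ xE); rewrite sE // linearZ /= => ZX.
by rewrite mulrC -scalerA ZX scalerA mulVf ?scale1r // lt_eqF.
Qed.

End RiemannianPart.

(** * Hyperbolic planes *)

Section HyperbolicPlane.
Variables (R : realType) (g : lieAlgType R) (v : vectType R) (D : dataSet g v).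
Notation A := (rho D).
Notation B := (metric_v D).
Hypothesis spacelike :
  forall u x, B u u < 0 -> B u x = 0 -> x != 0 -> 0 < B x x.
Variables e f : v.
Hypotheses (ee : B e e = 0) (ff : B f f = 0) (ef : B e f != 0).

Let e0 : e != 0. Proof. by apply: contra_neq ef => ->; rewrite symform0l. Qed.
Let f0 : f != 0. Proof. by apply: contra_neq ef => ->; rewrite symform0r. Qed.

Lemma hyperbolic_form a b c d :
  B (a *: e + b *: f) (c *: e + d *: f) = (a * d + b * c) * B e f.
Proof. by rewrite !symformE ee ff (symformC _ f e); ring. Qed.

Lemma hyperbolic_directv : (<[e]> :&: <[f]> = 0)%VS.
Proof.
apply/eqP; rewrite -subv0; apply/subvP => x /memv_capP[/vlineP[a xe] /vlineP[b xf]].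
have : b * B e f = 0 by rewrite -symformZr -xf xe symformZr ee mulr0.
by move/eqP; rewrite mulf_eq0 (negPf ef) orbF xf => /eqP ->; rewrite scale0r mem0v.
Qed.

Lemma dim_hyperbolic : \dim (<[e]> + <[f]>) = 2%N.
Proof. by rewrite dimv_disjoint_sum ?dim_vline ?e0 ?f0 // hyperbolic_directv. Qed.

Lemma mem_hyperbolic x :
  x \in (<[e]> + <[f]>)%VS -> exists a b, x = a *: e + b *: f.
Proof. by move=> /memv_addP[_ /vlineP[a ->] [_ /vlineP[b ->] ->]]; exists a, b. Qed.

Let line_e : e \in (<[e]> + <[f]>)%VS.
Proof. by apply: (subvP (addvSl _ _)); apply: memv_line. Qed.
Let line_f : f \in (<[e]> + <[f]>)%VS.
Proof. by apply: (subvP (addvSr _ _)); apply: memv_line. Qed.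

(** The coefficient makes the square - 2 (B e f)^2, whatever the sign of
    B e f. *)
Definition hyperbolic_timelike := e - (B e f) *: f.

Lemma hyperbolic_timelike_lt0 : B hyperbolic_timelike hyperbolic_timelike < 0.
Proof.
rewrite /hyperbolic_timelike -[X in X - _]scale1r -scaleNr hyperbolic_form.
rewrite mul1r mulr1 mulrDl mulNr -expr2 -opprD oppr_lt0.
by rewrite addr_gt0 // exprn_even_gt0.
Qed.

Lemma hyperbolic_timelike_mem : hyperbolic_timelike \in (<[e]> + <[f]>)%VS.
Proof. by rewrite memvB ?memvZ. Qed.

Lemma hyperbolic_lorentzian : lorentzian_sub D (<[e]> + <[f]>)%VS.
Proof.
apply/lorentzianP; split=> [|x y].
  exists (vsproj _ hyperbolic_timelike).
  by rewrite /= /restr_form vsprojK ?hyperbolic_timelike_mem ?hyperbolic_timelike_lt0.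
rewrite /= /restr_form => xx xy y0; apply: spacelike xx xy _.
by move: y0; rewrite -(inj_eq (@subvs_inj _ _ _)) linear0.
Qed.

Lemma hyperbolic_radical0 :
  ((<[e]> + <[f]>) :&: orthov B (<[e]> + <[f]>) = 0)%VS.
Proof.
apply/eqP; rewrite -subv0; apply/subvP => x /memv_capP[/mem_hyperbolic[a [b ->]]].
move=> /mem_orthovP orth.
have := orth e line_e; have := orth f line_f.
rewrite !symformE ee ff (symformC _ f e) !mulr0 addr0 add0r.
move=> /eqP + /eqP; rewrite !mulf_eq0 (negPf ef) !orbF => /eqP -> /eqP ->.
by rewrite !scale0r addr0 mem0v.
Qed.

Lemma hyperbolic_orthov_posdef : posdef_on D (orthov B (<[e]> + <[f]>)%VS).
Proof.
move=> x /mem_orthovP xV x0; apply: (spacelike hyperbolic_timelike_lt0) => //.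
by rewrite symformC xV ?hyperbolic_timelike_mem.
Qed.

Variables (Z : g) (a : R).
Hypotheses (a0 : a != 0) (Ze : A Z e = a *: e) (Zf : A Z f = - a *: f).
Hypotheses (inv_e : rep_invariant D <[e]>%VS) (inv_f : rep_invariant D <[f]>%VS).

Lemma hyperbolic_invariant : rep_invariant D (<[e]> + <[f]>)%VS.
Proof. by move=> X; rewrite limgD addvS. Qed.

(** J is A Z / a, with eigenvalue 1 on e and -1 on f. By skewness any A X has
    opposite eigenvalues on e and f, so it is a multiple of J. *)
Lemma hyperbolic_structure :
  exists (J : 'End(subvs_of (<[e]> + <[f]>)%VS)) (lambda : g -> R),
    [/\ in_so_sub D J, (J \o J)%VF = \1%VF & forall X, acts_as D X (lambda X) J].
Proof.
have invV : {in (<[e]> + <[f]>)%VS, forall x, (a^-1 *: A Z) x \in (<[e]> + <[f]>)%VS}.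
  move=> x xV; rewrite scale_lfunE memvZ //.
  by move/rep_invariantP: hyperbolic_invariant; apply.
have JE x := restrE x invV.
have Zpq p q : A Z (p *: e + q *: f) = (p * a) *: e + (- (q * a)) *: f.
  by rewrite linearD !linearZ /= Ze Zf !scalerA mulrN.
exists (restr _ (a^-1 *: A Z)), (fun X => B (A X e) f / B e f); split.
- move=> x y; rewrite /= /restr_form !JE !scale_lfunE symformZl symformZr.
  by rewrite rho_skew mulrN.
- apply/lfunP => x; apply: subvs_inj; rewrite comp_lfunE id_lfunE !JE.
  have [p [q ->]] := mem_hyperbolic (subvsP x).
  rewrite !scale_lfunE Zpq [A Z (_ *: _)]linearZ /= Zpq scalerA scalerDr !scalerA.
  by congr (_ *: _ + _ *: _); field.
- move=> X x; rewrite JE scale_lfunE; have [p [q ->]] := mem_hyperbolic (subvsP x).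
  have [c Xe] := (rep_invariant_lineP D e).1 inv_e X.
  have [d Xf] := (rep_invariant_lineP D f).1 inv_f X.
  have cd : d = - c.
    have := rho_skew D X e f; rewrite Xe Xf symformZl symformZr => cd.
    by apply: (mulIf ef); rewrite mulNr cd opprK.
  rewrite Zpq linearD !linearZ /= Xe Xf symformZl mulfK // cd.
  rewrite [RHS]scalerA scalerDr !scalerA.
  by congr (_ *: _ + _ *: _); field.
Qed.

End HyperbolicPlane.

(** * The decomposition theorem *)

(** J comes from a central element acting non-trivially if there is one.
    Otherwise the center imposes no condition on J, and only the parity of the
    dimension matters. *)
Lemma irreducible_center_structure (R : realType) (g : lieAlgType R)
    (v : vectType R) (D : dataSet g v) (E : {vspace v}) :
    rep_irreducible D E -> posdef_on D E ->
  (exists (J : 'End(subvs_of E)) (lambda : g -> R),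
      [/\ in_so_sub D J, (J \o J)%VF = - \1%VF
        & forall Z : g, in_center Z -> acts_as D Z (lambda Z) J])
  \/ (odd (\dim E) /\
      forall Z : g, in_center Z -> forall x, x \in E -> rho D Z x = 0).
Proof.
move=> irrE pos.
have [[Z [cZ nz]]|triv] := pselect (exists Z : g,
    in_center Z /\ exists2 x, x \in E & rho D Z x != 0).
  have [t [t0 ZZ /boolp.choice[l lE]]] := center_complex_structure irrE pos cZ nz.
  have [/rep_invariantP iE _ _] := irrE.
  have invE : {in E, forall x, (t^-1 *: rho D Z) x \in E}.
    by move=> x xE; rewrite scale_lfunE memvZ ?iE.
  left; exists (restr E (t^-1 *: rho D Z)), l; split.
  - move=> x y; rewrite /= /restr_form !restrE // !scale_lfunE symformZl symformZr.
    by rewrite rho_skew mulrN.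
  - apply/lfunP => x; apply: subvs_inj.
    rewrite comp_lfunE opp_lfunE id_lfunE !restrE // !scale_lfunE [rho D Z (_ *: _)]linearZ /=.
    rewrite ZZ ?subvsP // !scalerA -scaleN1r; congr (_ *: _).
    by field.
  - move=> X cX x; rewrite restrE // scale_lfunE scalerA.
    exact: lE cX _ (subvsP x).
have {}triv Z : in_center Z -> forall x, x \in E -> rho D Z x = 0.
  move=> cZ x xE; apply/eqP/negPn/negP => nz; apply: triv; exists Z.
  by split=> //; exists x.
have [oddE|evenE] := boolP (odd (\dim E)); [by right|left].
have [|J [soJ JJ]] := even_complex_structure (posdef_riemannian_sub pos).
  by rewrite dimvf.
exists J, (fun=> 0); split=> // Z cZ x.
by rewrite triv ?subvsP // scale0r.
Qed.

(* The second alternative in the clause on V i, i != 0, is needed: an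
   odd-dimensional space carries no J with J^2 = -Id, and odd-dimensional V i do
   occur, e.g. for g = so(3) + R acting on R^3 + R^(1,1). *)
Theorem theorem3p10 (R : realType) (g : lieAlgType R) (v : vectType R)
    (D : dataSet g v) :
  lorentzian_dataSet D -> lorentzian (metric_v D) ->
  exists (k : nat) (V : 'I_k.+1 -> {vspace v}),
    [/\ [/\ (\sum_(i < k.+1) V i)%VS = fullv
          , directv (\sum_(i < k.+1) V i)%VS
          , forall i j, i != j -> (V i <= orthov (metric_v D) (V j))%VS
          , forall i, rep_invariant D (V i)
          & (forall i, i != ord0 ->
               riemannian_sub D (V i) /\ rep_irreducible D (V i)) /\
            [/\ lorentzian_sub D (V ord0)
              , \dim (V ord0) = 2%N
              & exists e f : v,
                  [/\ lightlike (metric_v D) e, lightlike (metric_v D) f,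
                      rep_irreducible D <[e]>, rep_irreducible D <[f]>
                    & V ord0 = (<[e]> + <[f]>)%VS /\
                      directv (<[e]> + <[f]>)%VS]]]
      , forall i, i != ord0 ->
          (exists (J : 'End(subvs_of (V i))) (lambda : g -> R),
             [/\ in_so_sub D J, (J \o J)%VF = - \1%VF
               & forall Z : g, in_center Z -> acts_as D Z (lambda Z) J])
          \/ (odd (\dim (V i)) /\
              forall Z : g, in_center Z -> forall x, x \in V i -> rho D Z x = 0)
      & exists (J : 'End(subvs_of (V ord0))) (lambda : g -> R),
          [/\ in_so_sub D J, (J \o J)%VF = \1%VF
            & forall Z : g, in_center Z -> acts_as D Z (lambda Z) J]].
Proof.
move=> lorD lorB; have posg := metric_g_riemannian lorD lorB.
have [[u u0] spacelike] := (lorentzianP _).1 lorB.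
have [Z [a [e [a0 e0 Ze]]]] := exists_boost posg spacelike u0.
have [f [f0 Zf ef]] := opposite_boost_vector spacelike u0 a0 e0 Ze.
have Na0 : - a != 0 by rewrite oppr_eq0.
have ee := boost_null a0 Ze; have ff := boost_null Na0 Zf.
have inv_e := boost_line_invariant posg spacelike u0 a0 e0 Ze.
have inv_f := boost_line_invariant posg spacelike u0 Na0 f0 Zf.
set V0 := (<[e]> + <[f]>)%VS.
have inv0 : rep_invariant D V0 by apply: hyperbolic_invariant.
have rad0 := hyperbolic_radical0 ee ff ef.
have pos0 := hyperbolic_orthov_posdef spacelike ee ff ef.
have [k [W [sumW orthW irrW]]] :=
  orthogonal_decomposition (rep_invariant_orthov inv0) pos0.
have WV0 i : (W i <= orthov (metric_v D) V0)%VS by rewrite -sumW (sumv_sup i).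
have posW i : posdef_on D (W i) := posdef_onS (WV0 i) pos0.
have orthV := orthogonal_cons_family orthW WV0.
exists k, (cons_family V0 W); split.
- split.
  + by rewrite sum_cons_family sumW addv_orthov.
  + apply: orthogonal_directv orthV _ => i; case: (unliftP ord0 i) => [j ->|->].
      by rewrite cons_familyS; apply: posdef_radical0 (posW j).
    by rewrite cons_family0.
  + exact: orthV.
  + move=> i; case: (unliftP ord0 i) => [j ->|->]; rewrite ?cons_family0 //.
    by rewrite cons_familyS; case: (irrW j).
  split.
    move=> i; case: (unliftP ord0 i) => [j -> _|->]; last by rewrite eqxx.
    by rewrite cons_familyS; split=> //; apply: posdef_riemannian_sub.
  rewrite cons_family0; split.
  + exact: hyperbolic_lorentzian.
  + exact: dim_hyperbolic ee ef.
  exists e, f; split=> //.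
  + exact: rep_irreducible_line.
  + exact: rep_irreducible_line.
  + by split=> //; apply/directv_addP; apply: hyperbolic_directv ee ef.
- move=> i; case: (unliftP ord0 i) => [j -> _|->]; last by rewrite eqxx.
  by rewrite cons_familyS; apply: irreducible_center_structure.
- rewrite cons_family0.
  have [J [lambda [soJ JJ actJ]]] := hyperbolic_structure ef a0 Ze Zf inv_e inv_f.
  by exists J, lambda; split=> // X _; apply: actJ.
Qed.
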